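(* Let $M\ge1$ be an integer and let $|\psi_0\rangle=|+\rangle^{\otimes M}$, where $|+\rangle=(|0\rangle+|1\rangle)/\sqrt2$. For the $M$-qubit local dephasing channel with error probability $p\in[0,1]$, the PQES error threshold for the target $|\psi_0\rangle$ is $$p_{\mathrm{th}}=\frac12 .$$
   Context: Local dephasing channel: $\mathcal{E}_z=\mathcal{E}^{(z)}_1\circ\cdots\circ\mathcal{E}^{(z)}_M$ on operators on $(\mathbb{C}^2)^{\otimes M}$, where $$\mathcal{E}^{(z)}_m(\rho)=(1-p)\rho+p\,Z_m\rho Z_m$$ and $Z_m$ is the Pauli $Z$ operator acting on qubit $m$ and as the identity elsewhere. Purification map: for an integer $\ell\ge0$ and a density matrix $\rho$, $\mathcal{P}_\ell(\rho)=\rho^{N}/\mathrm{Tr}(\rho^{N})$ with $N=2^\ell$. Effective logical error rate: one cycle applies the error channel and then $\mathcal{P}_\ell$. With $F(t)$ the fidelity $\langle\psi_0|\rho|\psi_0\rangle$ after $t$ cycles starting from $|\psi_0\rangle\langle\psi_0|$, $$\gamma_L(\ell,p)=F(0)-F(1)=1-\langle\psi_0|\,\mathcal{P}_\ell\big(\mathcal{E}_z(|\psi_0\rangle\langle\psi_0|)\big)|\psi_0\rangle .$$ PQES (purification quantum error suppression) error threshold: $p_{\mathrm{th}}$ is the largest value in $[0,1]$ such that $\lim_{\ell\to\infty}\gamma_L(\ell,p)=0$ for every $p\in[0,1]$ with $p<p_{\mathrm{th}}$. *)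

(* Defs.v *)
From mathcomp Require Import all_boot all_order all_algebra.
From mathcomp Require Import all_classical all_reals all_analysis.
From mathcomp Require Import complex mxtens.
Import numFieldNormedType.Exports.

Set Implicit Arguments.
Unset Strict Implicit.
Unset Printing Implicit Defensive.

Import Order.TTheory GRing.Theory Num.Theory.

Local Open Scope classical_set_scope.
Local Open Scope complex_scope.
Local Open Scope sesquilinear_scope.
Local Open Scope ring_scope.

Section TensorPowers.
Variable R : realType.

(* A 0 *t A 1 *t ... *t A (M - 1); factor 0 is the leftmost, and the cast is
   along 2 ^ M.+1 = 2 * 2 ^ M. *)
Fixpoint tensor_op (M : nat) : ('I_M -> 'M[R[i]]_2) -> 'M[R[i]]_(2 ^ M) :=
  match M with
  | 0 => fun=> 1%:M
  | M'.+1 => fun A =>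
      castmx (esym (expnS 2 M'), esym (expnS 2 M'))
        (A ord0 *t tensor_op (fun i => A (lift ord0 i)))
  end.

Fixpoint tensor_ket (M : nat) : ('I_M -> 'cV[R[i]]_2) -> 'cV[R[i]]_(2 ^ M) :=
  match M with
  | 0 => fun=> 1%:M
  | M'.+1 => fun v =>
      castmx (esym (expnS 2 M'), muln1 1)
        (v ord0 *t tensor_ket (fun i => v (lift ord0 i)))
  end.

End TensorPowers.

Section Dephasing.
Variable R : realType.

Definition ket (b : 'I_2) : 'cV[R[i]]_2 := delta_mx b 0.

Definition ket_plus : 'cV[R[i]]_2 := (sqrtC 2)^-1 *: (ket 0 + ket 1).

Definition plus_state (M : nat) : 'cV[R[i]]_(2 ^ M) :=
  tensor_ket (fun _ : 'I_M => ket_plus).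

Definition pauliZ : 'M[R[i]]_2 := delta_mx 0 0 - delta_mx 1 1.

Definition pauliZ_at (M : nat) (m : 'I_M) : 'M[R[i]]_(2 ^ M) :=
  tensor_op (fun k => if k == m then pauliZ else 1%:M).

Definition dephase_at (M : nat) (p : R) (m : 'I_M) (rho : 'M[R[i]]_(2 ^ M)) :
    'M[R[i]]_(2 ^ M) :=
  (1 - p)%:C *: rho + p%:C *: (pauliZ_at m *m rho *m pauliZ_at m).

Definition dephasing (M : nat) (p : R) :
    'M[R[i]]_(2 ^ M) -> 'M[R[i]]_(2 ^ M) :=
  \big[comp/id]_(m < M) dephase_at p m.

End Dephasing.

Section Purification.
Variables (R : realType) (d : nat).
Implicit Types (E : 'M[R[i]]_d -> 'M[R[i]]_d) (psi : 'cV[R[i]]_d).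
Implicit Types (rho : 'M[R[i]]_d).

Definition purify (l : nat) rho : 'M[R[i]]_d :=
  (\tr (rho ^+ (2 ^ l)))^-1 *: rho ^+ (2 ^ l).

Definition cycle E (l : nat) rho : 'M[R[i]]_d := purify l (E rho).

Definition fidelity psi rho : R[i] := (psi ^t* *m rho *m psi) 0 0.

Definition fidelity_after E psi (l t : nat) : R[i] :=
  fidelity psi (iter t (cycle E l) (psi *m psi ^t*)).

(* For a unit vector psi the first term is 1. *)
Definition gammaL E psi (l : nat) : R[i] :=
  fidelity_after E psi l 0 - fidelity_after E psi l 1.

(* The ascription provides the topology of the field R[i]: the library attaches
   it to numFieldType, not to R[i] itself. *)
Definition suppressed E psi : Prop :=
  (gammaL E psi l : (R[i] : numFieldType)) @[l --> \oo]
    --> (0 : (R[i] : numFieldType)).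

Definition admissible (E : R -> 'M[R[i]]_d -> 'M[R[i]]_d) psi : set R :=
  [set q | 0 <= q <= 1 /\
     forall p, 0 <= p <= 1 -> p < q -> suppressed (E p) psi].

Definition is_PQES_threshold (E : R -> 'M[R[i]]_d -> 'M[R[i]]_d) psi (pth : R) :
    Prop :=
  admissible E psi pth /\ ubound (admissible E psi) pth.

End Purification.

(* Main.v *)
Require Import Defs.
From mathcomp Require Import all_boot all_order all_algebra.
From mathcomp Require Import all_classical all_reals all_analysis.
From mathcomp Require Import complex mxtens ring lra.
Import numFieldNormedType.Exports.
Set Implicit Arguments.
Unset Strict Implicit.
Unset Printing Implicit Defensive.
Import Order.TTheory GRing.Theory Num.Theory.
Local Open Scope classical_set_scope.
Local Open Scope complex_scope.
Local Open Scope sesquilinear_scope.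
Local Open Scope ring_scope.

(** Dephasing acts factorwise, so it turns [|+><+|] tensored [M] times into the
    [M]-th tensor power of [(1 - p) |+><+| + p |-><-|]. The two projectors are
    orthogonal, so with [N = 2 ^ l] the [N]-th power replaces the weights by
    [(1 - p) ^ N] and [p ^ N], and
      [gammaL = 1 - ((1 - p) ^ N / ((1 - p) ^ N + p ^ N)) ^ M].
    This tends to 0 when [p < 1 / 2], since [(p / (1 - p)) ^ N] does, and at
    [p = 1 / 2] it is constantly [1 - 2 ^ -M], which is nonzero. *)

(** * Tensor powers: products, powers, traces and multilinearity *)

Section Tensor.
Variable R : realType.
Local Notation C := R[i].

(** The casts in [tensor_op] and [tensor_ket] are moved outwards; once the dimension equations are
    eliminated, each cast is the identity. *)
Lemma castmx_mulmx (m m' n n' p p' : nat) (em : m = m') (en : n = n')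
    (ep : p = p') (A : 'M[C]_(m, n)) (B : 'M[C]_(n, p)) :
  castmx (em, en) A *m castmx (en, ep) B = castmx (em, ep) (A *m B).
Proof. by case: m' / em; case: n' / en; case: p' / ep. Qed.

Lemma castmx_linear (m m' n n' : nat) (e : (m = m') * (n = n')) (a b : C)
    (A B : 'M[C]_(m, n)) :
  castmx e (a *: A + b *: B) = a *: castmx e A + b *: castmx e B.
Proof. by case: e => em en; case: m' / em; case: n' / en. Qed.

Lemma mxtrace_castmx (n n' : nat) (e : n = n') (A : 'M[C]_n) :
  \tr (castmx (e, e) A) = \tr A.
Proof. by case: n' / e. Qed.

Lemma castmx1 (n n' : nat) (e : n = n') :
  castmx (e, e) (1%:M : 'M[C]_n) = 1%:M.
Proof. by case: n' / e. Qed.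

Lemma castmx_adj (m m' n n' : nat) (em : m = m') (en : n = n')
    (A : 'M[C]_(m, n)) :
  (castmx (em, en) A) ^t* = castmx (en, em) (A ^t*).
Proof. by case: m' / em; case: n' / en. Qed.

Lemma mxtrace_tens (m n : nat) (A : 'M[C]_m) (B : 'M[C]_n) :
  \tr (A *t B) = \tr A * \tr B.
Proof. by rewrite /mxtrace mulr_sum; apply: eq_bigr => i _; rewrite mxE. Qed.

Lemma tensmx1 (m n : nat) : (1%:M : 'M[C]_m) *t (1%:M : 'M[C]_n) = 1%:M.
Proof.
apply/matrixP=> i j.
case: (mxtens_indexP i) => i0 i1; case: (mxtens_indexP j) => j0 j1.
by rewrite tensmxE !mxE -natrM mulnb (can_eq (@mxtens_indexK _ _)).
Qed.

Lemma adj_tens (m n p q : nat) (A : 'M[C]_(m, n)) (B : 'M[C]_(p, q)) :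
  (A *t B) ^t* = A ^t* *t B ^t*.
Proof. by apply/matrixP=> i j; rewrite !mxE rmorphM. Qed.

Lemma eq_tensor_op (M : nat) (A B : 'I_M -> 'M[C]_2) :
  A =1 B -> tensor_op A = tensor_op B.
Proof. by move=> AB; congr tensor_op; apply/funext. Qed.

Lemma tensor_op_mul (M : nat) (A B : 'I_M -> 'M[C]_2) :
  tensor_op A *m tensor_op B = tensor_op (fun k => A k *m B k).
Proof.
elim: M A B => [|M IH] A B /=; first by rewrite mul1mx.
by rewrite castmx_mulmx tensmx_mul IH.
Qed.

Lemma tensor_op1 (M : nat) : tensor_op (fun _ : 'I_M => 1%:M : 'M[C]_2) = 1%:M.
Proof. by elim: M => //= M ->; rewrite tensmx1 castmx1. Qed.

Lemma tensor_op_exp (M n : nat) (A : 'I_M -> 'M[C]_2) :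
  tensor_op A ^+ n = tensor_op (fun k => A k ^+ n).
Proof.
elim: n => [|n IH].
  by rewrite expr0; exact: esym (tensor_op1 M).
rewrite exprS IH [LHS]tensor_op_mul; apply: eq_tensor_op => k.
by rewrite exprS.
Qed.

Lemma mxtrace_tensor_op (M : nat) (A : 'I_M -> 'M[C]_2) :
  \tr (tensor_op A) = \prod_(k < M) \tr (A k).
Proof.
elim: M A => [|M IH] A /=; first by rewrite big_ord0 mxtrace1.
by rewrite mxtrace_castmx mxtrace_tens IH big_ord_recl.
Qed.

(** Induction on the number of factors: if [m] lies in the tail, the heads agree and the induction
    hypothesis splits the tail; if [m] is [ord0], the tails agree. Bilinearity of [*t] finishes both
    cases. *)
Lemma tensor_op_multilinear (M : nat) (m : 'I_M) (a b : C)
    (A B D : 'I_M -> 'M[C]_2) :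
  A m = a *: B m + b *: D m ->
  (forall k, k != m -> A k = B k) -> (forall k, k != m -> A k = D k) ->
  tensor_op A = a *: tensor_op B + b *: tensor_op D.
Proof.
elim: M m A B D => [[]//|M IH] m A B D Am AB AD /=.
case: (unliftP ord0 m) => [j|] mE; subst m.
  rewrite (IH j _ (fun i => B (lift ord0 i)) (fun i => D (lift ord0 i))) //.
  - rewrite -AB // -AD // -castmx_linear; congr castmx.
    by apply/matrixP=> x y; rewrite !mxE; ring.
  - by move=> k kj; apply: AB; rewrite (inj_eq lift_inj).
  - by move=> k kj; apply: AD; rewrite (inj_eq lift_inj).
have -> : (fun i => B (lift ord0 i)) = (fun i => A (lift ord0 i)).
  by apply/funext => i; rewrite AB.
have -> : (fun i => D (lift ord0 i)) = (fun i => A (lift ord0 i)).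
  by apply/funext => i; rewrite AD.
rewrite -castmx_linear Am; congr castmx.
by apply/matrixP=> x y; rewrite !mxE; ring.
Qed.

Lemma tensor_ket_outer (M : nat) (v : 'I_M -> 'cV[C]_2) :
  tensor_ket v *m (tensor_ket v) ^t* = tensor_op (fun k => v k *m (v k) ^t*).
Proof.
elim: M v => [|M IH] v /=.
  by rewrite mul1mx; apply/matrixP=> i j; rewrite !mxE !ord1 rmorph1.
by rewrite castmx_adj castmx_mulmx adj_tens tensmx_mul IH.
Qed.

(** In trace form, the fidelity of a tensor power becomes a product over the factors. *)
Lemma fidelityE (d : nat) (psi : 'cV[C]_d) (rho : 'M[C]_d) :
  fidelity psi rho = \tr (psi *m psi ^t* *m rho).
Proof. by rewrite /fidelity -[in RHS]mulmxA mxtrace_mulC /mxtrace big_ord1. Qed.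

End Tensor.

(** * Dephasing of the plus state and its error rate *)

Section Dephase.
Variable R : realType.
Local Notation C := R[i].

Definition dephase1 (p : R) (A : 'M[C]_2) : 'M[C]_2 :=
  (1 - p)%:C *: A + p%:C *: (pauliZ R *m A *m pauliZ R).

Lemma dephase_at_tensor (M : nat) (p : R) (m : 'I_M) (A : 'I_M -> 'M[C]_2) :
  dephase_at p m (tensor_op A) =
  tensor_op (fun k => if k == m then dephase1 p (A k) else A k).
Proof.
rewrite /dephase_at /pauliZ_at !tensor_op_mul; apply/esym.
apply: (@tensor_op_multilinear _ _ m); first by rewrite eqxx.
  by move=> k /negbTE ->.
by move=> k /negbTE ->; rewrite mul1mx mulmx1.
Qed.

Lemma dephasing_tensor (M : nat) (p : R) (A : 'I_M -> 'M[C]_2) :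
  dephasing p (tensor_op A) = tensor_op (fun k => dephase1 p (A k)).
Proof.
rewrite /dephasing.
(* Generalised to a list of qubits for the induction; without duplicates, each factor is dephased at
   most once. *)
have H s : uniq s -> (\big[comp/id]_(m <- s) dephase_at p m) (tensor_op A) =
    tensor_op (fun k => if k \in s then dephase1 p (A k) else A k).
  elim: s => [|m s IH] /=; first by rewrite big_nil.
  case/andP=> ms us; rewrite big_cons /= IH // dephase_at_tensor.
  apply: eq_tensor_op => k; rewrite inE.
  by case: eqVneq => //= ->; rewrite (negbTE ms).
rewrite H ?index_enum_uniq //; apply: eq_tensor_op => k.
by rewrite mem_index_enum.
Qed.

Definition plus_proj : 'M[C]_2 := ket_plus R *m (ket_plus R) ^t*.
(** This is |-><-|, because Z|+> = |->; in this form it appears literally in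
    [dephase1 p plus_proj]. *)
Definition minus_proj : 'M[C]_2 := pauliZ R *m plus_proj *m pauliZ R.

Lemma plus_projE : plus_proj = const_mx 2^-1.
Proof.
apply/matrixP=> i j; rewrite !mxE big_ord1 !mxE.
have e01 (k : 'I_2) : (k == 0)%:R + (k == 1)%:R = 1 :> C.
  by case: k => [[|[|k]] hk] //=; rewrite ?addr0 ?add0r.
rewrite !eqxx !andbT !e01 !mulr1 conj_Creal ?rpredV ?sqrtC_real ?ler0n //.
by rewrite -expr2 exprVn sqrtCK.
Qed.

Lemma minus_projE :
  minus_proj = \matrix_(i, j) (if i == j then 2^-1 else - 2^-1).
Proof.
(* As Z is diagonal, conjugation by it multiplies entry (i, j) by the product of two signs. *)
have ZE : pauliZ R = diag_mx (\row_j (if j == 0 then 1 else -1)).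
  by apply/matrixP=> [[[|[|i]] hi] [[|[|j]] hj]] //; rewrite !mxE //=; ring.
rewrite /minus_proj plus_projE ZE mul_diag_mx mul_mx_diag.
apply/matrixP=> [[[|[|i]] hi] [[|[|j]] hj]] //; rewrite !mxE //=; ring.
Qed.

Lemma plus_minus_proj_mul :
  [/\ plus_proj *m plus_proj = plus_proj, plus_proj *m minus_proj = 0,
      minus_proj *m plus_proj = 0 & minus_proj *m minus_proj = minus_proj].
Proof.
rewrite minus_projE plus_projE; split;
  apply/matrixP=> [[[|[|i]] hi] [[|[|j]] hj]] //;
  rewrite !mxE !big_ord_recl big_ord0 !mxE //=; by field.
Qed.

Lemma mxtrace_plus_proj : \tr plus_proj = 1.
Proof.
by rewrite plus_projE /mxtrace !big_ord_recl big_ord0 !mxE addr0; field.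
Qed.

Lemma mxtrace_minus_proj : \tr minus_proj = 1.
Proof.
rewrite minus_projE /mxtrace !big_ord_recl big_ord0 !mxE !eqxx addr0.
by field.
Qed.

(** The cross terms vanish by orthogonality, so the weights are powered separately. The induction
    starts at exponent 1, where the formula is the definition of [dephase1]. *)
Lemma dephase1_plus_exp (p : R) (n : nat) :
  dephase1 p plus_proj ^+ n.+1 =
  (1 - p)%:C ^+ n.+1 *: plus_proj + p%:C ^+ n.+1 *: minus_proj.
Proof.
have [PP PQ QP QQ] := plus_minus_proj_mul.
elim: n => [//|n IH]; rewrite exprS IH -mulmxE /dephase1 -/minus_proj.
rewrite mulmxDl !mulmxDr -!scalemxAl -!scalemxAr.
by rewrite PP PQ QP QQ !scaler0 addr0 add0r !scalerA -!exprS.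
Qed.

(** Both the overlap with the target and the normalising trace are [M]-th powers of one-qubit
    traces: the overlap keeps only the weight of [plus_proj], the normalisation adds both
    weights. *)
Lemma gammaL_plus (M : nat) (p : R) (l : nat) :
  gammaL (@dephasing R M p) (plus_state R M) l =
  (1 - ((1 - p) ^+ (2 ^ l) /
        ((1 - p) ^+ (2 ^ l) + p ^+ (2 ^ l))) ^+ M)%:C.
Proof.
have [PP PQ QP QQ] := plus_minus_proj_mul.
have [N NE] : exists N, (2 ^ l = N.+1)%N.
  by exists (2 ^ l).-1; rewrite prednK ?expn_gt0.
have rho0 : plus_state R M *m (plus_state R M) ^t* =
    tensor_op (fun _ : 'I_M => plus_proj) by exact: tensor_ket_outer.
rewrite /gammaL /fidelity_after /= !fidelityE /Defs.cycle /purify rho0.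
rewrite dephasing_tensor tensor_op_exp NE -scalemxAr mxtraceZ !tensor_op_mul.
rewrite !mxtrace_tensor_op !prodr_const !card_ord PP mxtrace_plus_proj expr1n.
rewrite dephase1_plus_exp mulmxDr -!scalemxAr PP PQ scaler0 addr0.
rewrite mxtraceD !mxtraceZ mxtrace_plus_proj mxtrace_minus_proj !mulr1.
move: (1 - p) => a; rewrite [RHS]rmorphB rmorph1 rmorphXn rmorphM fmorphV.
rewrite rmorphD !rmorphXn.
by rewrite expr_div_n mulrC.
Qed.

(** * Limits, and the threshold *)

Lemma cvg_real_complex (u : nat -> R) (a : R) :
  ((u l)%:C : (C : numFieldType)) @[l --> \oo] -->
    (a%:C : (C : numFieldType)) <->
  u l @[l --> \oo] --> a.
Proof.
have nE (x : R) : `|x%:C| = `|x|%:C.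
  by rewrite normc_def /= expr0n /= addr0 sqrtr_sqr.
split=> /cvgrPdist_lt H; apply/cvgrPdist_lt => e e0.
  near=> l; rewrite -ltcR -nE rmorphB; near: l; apply: H.
  by rewrite (_ : 0 = 0%:C) // ltcR.
(* Here [e] is complex, but in the partial order of [R[i]] a positive element is real. *)
have eE : e = (complex.Re e)%:C by rewrite RRe_real // gtr0_real.
rewrite eE; near=> l; rewrite -rmorphB nE ltcR; near: l; apply: H.
by rewrite -ltcR -eE.
Unshelve. all: by end_near.
Qed.

Lemma cvg_exp_pow2 (x : R) : `|x| < 1 -> x ^+ (2 ^ l) @[l --> \oo] --> (0 : R).
Proof.
move=> x1.
apply: (@cvg_comp _ _ _ (fun l => 2 ^ l)%N (fun n => x ^+ n) \oo \oo).
  (* The sequence is a subsequence of the geometric one, with indices tending to infinity because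
     [l < 2 ^ l]. *)
  move=> A [n _ nA]; exists n => // l /= nl; apply: nA => /=.
  by apply: (leq_trans nl); apply: ltnW; apply: ltn_expl.
exact: cvg_expr.
Qed.

End Dephase.

Theorem mainTheorem4 (R : realType) (M : nat) (hM : (1 <= M)%N) :
  is_PQES_threshold (@dephasing R M) (plus_state R M) (1 / 2).
Proof.
split; first split; first lra.
- move=> p p01 p2; rewrite /suppressed.
  under eq_fun do rewrite gammaL_plus.
  apply/(@cvg_real_complex R _ 0).
  have a0 : 0 < 1 - p by lra.
  have x1 : `|p / (1 - p)| < 1.
    by rewrite ger0_norm ?divr_ge0 ?ltr_pdivrMr //; lra.
  (* Dividing by the dominant weight leaves [l] only in a power of a ratio below 1. *)
  have E l : (1 - p) ^+ (2 ^ l) / ((1 - p) ^+ (2 ^ l) + p ^+ (2 ^ l)) =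
      (1 + (p / (1 - p)) ^+ (2 ^ l))^-1.
    have aN : 0 < (1 - p) ^+ (2 ^ l) by rewrite exprn_gt0.
    have bN : 0 <= p ^+ (2 ^ l) by rewrite exprn_ge0 //; lra.
    by rewrite expr_div_n; field; lra.
  under eq_fun do rewrite E.
  (* The limit is written in the shape of the sequence, so that continuity applies term by term. *)
  have -> : 0 = 1 - (1 + 0)^-1 ^+ M :> R by rewrite addr0 invr1 expr1n subrr.
  apply: cvgB; first exact: cvg_cst.
  apply: (@cvg_comp _ _ _ (fun l => (1 + (p / (1 - p)) ^+ (2 ^ l))^-1)
    (fun x => x ^+ M)); last exact: exprn_continuous.
  apply: cvgV; first by rewrite addr0 oner_eq0.
  by apply: cvgD; [exact: cvg_cst | exact: cvg_exp_pow2].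
(* An admissible [q] above 1/2 would force suppression at [p = 1 / 2], where both weights coincide
   and the error rate is constant in [l]. *)
- move=> q [q01 Hq]; rewrite leNgt; apply/negP => q2.
  have := Hq (1 / 2) ltac:(lra) q2; rewrite /suppressed.
  under eq_fun do rewrite gammaL_plus.
  move/(@cvg_real_complex R _ 0).
  have E l : (1 - 1 / 2) ^+ (2 ^ l) /
      ((1 - 1 / 2) ^+ (2 ^ l) + (1 / 2) ^+ (2 ^ l)) = 1 / 2 :> R.
    rewrite (_ : 1 - 1 / 2 = 1 / 2 :> R); last lra.
    have : 0 < (1 / 2 : R) ^+ (2 ^ l) by rewrite exprn_gt0 //; lra.
    by move=> h; field; lra.
  under eq_fun do rewrite E.
  move=> /(@cvg_lim _ (@norm_hausdorff _ _)); rewrite lim_cst; last first.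
    exact: norm_hausdorff.
  move/eqP.
  (* [hM] enters here: (1/2)^M is below 1 only for a positive exponent. *)
  apply/negP; rewrite subr_eq0 eq_sym lt_eqF // exprn_ilt1 -?lt0n //; lra.
Qed.
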